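(* Let $m\ge n$, let $A\in\mathbb{R}^{m\times n}$ have full column rank, let $b\in\mathbb{R}^m$, let $x^*=(A^\top A)^{-1}A^\top b$, $r^*=Ax^*-b$ and $E_{\mathrm{uw}}=\frac1m\|r^*\|_2^2$. Assume that the vector $|r^*|=(|r_1^*|,\dots,|r_m^*|)^\top$ is not constant (i.e. not all its components are equal). Then there exist $\Delta>0$ and (locally, i.e. among points lying in a suitable fixed neighbourhood of the critical point $y^*=(\lambda^*,\mu^*,w^*,x^* )$) unique functions $\lambda(E)\in\mathbb{R}$, $\mu(E)\in\mathbb{R}$, $w(E)\in(0,\infty)^m$, $x(E)\in\mathbb{R}^n$, defined on the interval $(E_{\mathrm{uw}}-\Delta,E_{\mathrm{uw}})$, such that, for every $E$ in this interval: (a) $F(\lambda(E),\mu(E),w(E),x(E);E)=0$; (b) $\mu(E)>0$; (c) the point $(\lambda(E),\mu(E),w(E),x(E))$ solves (locally) the constrained entropy maximization problem, i.e. $(w(E),x(E))$ is a local maximizer of $H(w)=-\sum_{i=1}^m w_i\log w_i$ over the pairs $(w,x)\in\mathbb{R}^m\times\mathbb{R}^n$ with $w_i\ge 0$ for all $i$, $\sum_{i=1}^m w_i=1$ and $\sum_{i=1}^m w_i(a_i^\top x-b_i)^2=E$.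
   Context: $a_i^\top$ denotes the $i$th row of $A$, $u=(1,\dots,1)^\top\in\mathbb{R}^m$, $W=\mathrm{diag}(w)$; logarithm and square of a vector are taken componentwise, and $0\log 0=0$. For $\lambda,\mu\in\mathbb{R}$, $w\in(0,\infty)^m$, $x\in\mathbb{R}^n$ and a parameter $E$, the map $F=(F_1,F_2,F_3^\top,F_4^\top)^\top\in\mathbb{R}^{2+m+n}$ is $$F_1=u^\top w-1,\quad F_2=w^\top(Ax-b)^2-E,\quad F_3=\log w+(1+\lambda)u+\mu(Ax-b)^2,\quad F_4=A^\top WAx-A^\top Wb.$$ The critical point corresponding to ordinary least squares (uniform weights, $E=E_{\mathrm{uw}}$) is $y^*=(\lambda^*,\mu^*,w^*,x^* )$ with $\lambda^*=-(1+\log\frac1m)$, $\mu^*=0$, $w^*=\frac1m u$, $x^*=(A^\top A)^{-1}A^\top b$. *)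

(* Defs.v *)
From HB Require Import structures.
From mathcomp Require Import all_boot all_order all_algebra.
From mathcomp Require Import all_classical all_reals all_analysis.

Set Implicit Arguments.
Unset Strict Implicit.
Unset Printing Implicit Defensive.

Import Order.TTheory GRing.Theory Num.Theory.
Import numFieldNormedType.Exports.

Local Open Scope classical_set_scope.
Local Open Scope ring_scope.

Definition ones (R : realType) (m : nat) : 'cV[R]_m := const_mx 1.

Definition vsq (R : realType) (m : nat) (v : 'cV[R]_m) : 'cV[R]_m :=
  map_mx (fun t => t ^+ 2) v.

Definition vlog (R : realType) (m : nat) (v : 'cV[R]_m) : 'cV[R]_m :=
  map_mx (@ln R) v.

Definition norm2 (R : realType) (m : nat) (v : 'cV[R]_m) : R :=
  Num.sqrt (\sum_(i < m) v i 0 ^+ 2).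

Definition pos_vec (R : realType) (m : nat) (w : 'cV[R]_m) : Prop :=
  forall i : 'I_m, 0 < w i 0.

(* [ln] is total ([ln t = 0] for [t <= 0]), so [F] is meaningful only where
   [w] is positive. *)
Definition F (R : realType) (m n : nat) (A : 'M[R]_(m, n)) (b : 'cV[R]_m)
    (lambda mu : R) (w : 'cV[R]_m) (x : 'cV[R]_n) (E : R) :
    'cV[R]_(1 + 1 + m + n) :=
  let u := ones R m in
  let W := diag_mx w^T in
  let F1 : 'cV[R]_1 := u^T *m w - 1%:M in
  let F2 : 'cV[R]_1 := w^T *m vsq (A *m x - b) - E%:M in
  let F3 : 'cV[R]_m :=
    vlog w + (1 + lambda) *: u + mu *: vsq (A *m x - b) in
  let F4 : 'cV[R]_n := A^T *m W *m A *m x - A^T *m W *m b in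
  col_mx (col_mx (col_mx F1 F2) F3) F4.

Definition xstar (R : realType) (m n : nat) (A : 'M[R]_(m, n))
    (b : 'cV[R]_m) : 'cV[R]_n :=
  invmx (A^T *m A) *m A^T *m b.

Definition rstar (R : realType) (m n : nat) (A : 'M[R]_(m, n))
    (b : 'cV[R]_m) : 'cV[R]_m :=
  A *m xstar A b - b.

Definition Euw (R : realType) (m n : nat) (A : 'M[R]_(m, n))
    (b : 'cV[R]_m) : R :=
  m%:R^-1 * norm2 (rstar A b) ^+ 2.

Definition ystar (R : realType) (m n : nat) (A : 'M[R]_(m, n))
    (b : 'cV[R]_m) : R * R * 'cV[R]_m * 'cV[R]_n :=
  (- (1 + ln (m%:R^-1)), 0, m%:R^-1 *: ones R m, xstar A b).

(* The convention 0 log 0 = 0 holds since [0 * ln 0 = 0]. *)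
Definition entropy (R : realType) (m : nat) (w : 'cV[R]_m) : R :=
  - \sum_(i < m) w i 0 * ln (w i 0).

Definition feasible (R : realType) (m n : nat) (A : 'M[R]_(m, n))
    (b : 'cV[R]_m) (E : R) : set ('cV[R]_m * 'cV[R]_n) :=
  [set p : 'cV[R]_m * 'cV[R]_n |
    [/\ forall i : 'I_m, 0 <= p.1 i 0,
        \sum_(i < m) p.1 i 0 = 1
      & \sum_(i < m) p.1 i 0 * ((row i A *m p.2) 0 0 - b i 0) ^+ 2 = E]].

Definition local_maximizer (R : realType) (T : topologicalType) (S : set T)
    (f : T -> R) (p : T) : Prop :=
  S p /\ \forall q \near p, S q -> f q <= f p.

(* Main.v *)
Require Import Defs.
From HB Require Import structures.
From mathcomp Require Import all_boot all_order all_algebra.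
From mathcomp Require Import all_classical all_reals all_analysis.
From mathcomp Require Import ring lra.
Import Order.TTheory GRing.Theory Num.Theory.
Import numFieldNormedType.Exports.
Local Open Scope classical_set_scope.
Local Open Scope ring_scope.

(** Write [r(x) = A x - b].  For a multiplier [mu], the equations [F1 = 0] and
    [F3 = 0] force [w] to be the Gibbs weights
    [w_i = exp (- mu r_i(x)^2) / Z_mu(x)], with [Z_mu(x)] the sum of the
    numerators.  Then [F4 = 0] says that [x] is a stationary point of [Z_mu]
    (for [mu = 0], where [Z_mu] is constant, that [x] is [xstar]).  Hence the
    solutions of [F = 0] are parametrized by such pairs [(mu, x)] ([F_eq0P]),
    and what remains is to see that near [xstar] the energy is a strictly
    decreasing function of [mu >= 0].

    - Branch of stationary points.  Stationarity is the fixed-point equation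
      [x = xstar + P ((1 - exp (- mu r(x)^2)) r(x))], where
      [P = (A^T A)^-1 A^T].  Its right-hand side is constant at [mu = 0], so
      near [xstar] it is a contraction for small [mu], uniformly; Banach's
      theorem gives a locally unique stationary point, Lipschitz in [mu]
      ([gibbs_crit_branch]).
    - Maximality.  For small [mu >= 0] and bounded residuals, [exp (- mu s^2)]
      lies below its tangent in [s] with a quadratic margin
      ([expRN_sqr_tangent]), so a stationary point of [Z_mu] maximizes [Z_mu]
      among the nearby points.  With Gibbs's inequality
      [H(p) - mu <p, r(x)^2> <= ln Z_mu(x)], an equality exactly at the Gibbs
      weights, the pair [(w, x)] maximizes the Lagrangian [H - mu energy] over
      all weights and all [x] near [xstar].  On a level set of the energy this
      is the claimed local maximality ([gibbs_crit_local_maximizer]).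
    - Monotonicity.  Two Lagrangian maximizers, for [mu < nu], can be compared
      with each other in both problems; adding the two inequalities shows that
      the energy decreases, strictly because [|r|] is not constant near
      [xstar] ([fit_energy_decr]).  For [mu <= 0] the Gibbs weights favour
      large residuals, so the energy is at least [Euw]
      ([Euw_le_fit_energy]): solutions with [E < Euw] have [mu > 0].

    The intermediate value theorem then inverts the continuous, strictly
    decreasing map from [mu] to the energy on an interval [[0, mu0]], whose
    value at [0] is [Euw]. *)

(** * Elementary inequalities for the exponential and the logarithm *)

Section scalar.
Context {R : realType}.
Implicit Types a b p q t r s mu nu K : R.

Lemma expRN_le_quadratic t : - 2^-1 <= t -> expR (- t) <= 1 - t + 2 * t ^+ 2.
Proof.
move=> t_ge; have t1 : 0 < 1 + t by lra.
rewrite expRN -[leLHS]mul1r ler_pdivrMr ?expR_gt0//.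
have q0 : 0 <= 1 - t + 2 * t ^+ 2 by have := sqr_ge0 (t - 4^-1); nra.
apply: le_trans (ler_wpM2l q0 (expR_ge1Dx t)).
have -> : (1 - t + 2 * t ^+ 2) * (1 + t) = 1 + t ^+ 2 * (1 + 2 * t) by ring.
by rewrite lerDl mulr_ge0 ?sqr_ge0//; lra.
Qed.

Lemma sqr_norm_le r K : `|r| <= K -> r ^+ 2 <= K ^+ 2.
Proof.
move=> rK; rewrite -(real_normK (num_real r)).
by rewrite lerXn2r// ?nnegrE ?normr_ge0// (le_trans _ rK).
Qed.

(** The second-order Taylor remainder of [exp (- mu s^2)] at [s = r] is
    [O(mu^2 (s - r)^2)] on bounded sets, so for small [mu] it takes up at most
    half of the term [- mu (s - r)^2] of the expansion. *)
Lemma expRN_sqr_tangent mu K r s : 0 <= mu -> mu * K ^+ 2 <= 16^-1 ->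
    `|r| <= K -> `|s| <= K ->
  expR (- (mu * s ^+ 2)) <= expR (- (mu * r ^+ 2)) *
    (1 - 2 * mu * (r * (s - r)) - mu / 2 * (s - r) ^+ 2).
Proof.
move=> mu0 muK rK sK.
have -> : - (mu * s ^+ 2) = - (mu * r ^+ 2) + - (mu * (s ^+ 2 - r ^+ 2)).
  by ring.
rewrite expRD ler_wpM2l ?expR_ge0//.
have s2 := sqr_norm_le s K sK; have r2 := sqr_norm_le r K rK.
have muS := ler_wpM2l mu0 s2; have muR := ler_wpM2l mu0 r2.
have muS0 : 0 <= mu * s ^+ 2 by rewrite mulr_ge0// sqr_ge0.
apply: le_trans (expRN_le_quadratic _ _) _; first by lra.
have sr2 : (s + r) ^+ 2 <= 4 * K ^+ 2 by have := sqr_ge0 (s - r); nra.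
have -> : 2 * (mu * (s ^+ 2 - r ^+ 2)) ^+ 2 =
  mu * (s - r) ^+ 2 * (2 * (mu * (s + r) ^+ 2)) by ring.
have musr : 2 * (mu * (s + r) ^+ 2) <= 2^-1.
  by have := ler_wpM2l mu0 sr2; lra.
have md : 0 <= mu * (s - r) ^+ 2 by rewrite mulr_ge0// sqr_ge0.
have := ler_wpM2l md musr; lra.
Qed.

Lemma expRN_lipschitz a b : 0 <= a -> 0 <= b ->
  `|expR (- a) - expR (- b)| <= `|a - b|.
Proof.
move=> a0 b0; wlog ab : a b a0 b0 / a <= b => [H|].
  by have [/H->//|/ltW ba] := leP a b; rewrite distrC (distrC a) H.
have e0 : 0 <= expR (- a) - expR (- b) by rewrite subr_ge0 ler_expR; lra.
rewrite ger0_norm// ler0_norm ?subr_le0// opprB.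
have -> : expR (- b) = expR (- a) * expR (- (b - a)).
  by rewrite -expRD; congr expR; ring.
have := expR_ge1Dx (- (b - a)); have := @expR_le1 _ (- a).
have := expR_gt0 (- a); have : 0 <= b - a by lra.
rewrite oppr_le0 a0; set u := expR (- a); set v := expR (- (b - a)).
move=> ? ? /esym ? ?; nra.
Qed.

(** The part of a residual that the weight [exp (- mu r^2)] removes: the
    weighted normal equations are the ordinary ones with this perturbation. *)
Definition damping mu r := (1 - expR (- (mu * r ^+ 2))) * r.

Lemma damping0 r : damping 0 r = 0.
Proof. by rewrite /damping mul0r oppr0 expR0 subrr mul0r. Qed.

Lemma damping_lipschitz_param mu nu K r : 0 <= mu -> 0 <= nu -> `|r| <= K ->
  `|damping mu r - damping nu r| <= K ^+ 3 * `|mu - nu|.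
Proof.
move=> mu0 nu0 rK.
have -> : damping mu r - damping nu r =
  (expR (- (nu * r ^+ 2)) - expR (- (mu * r ^+ 2))) * r.
  by rewrite /damping; ring.
have K0 : 0 <= K by rewrite (le_trans _ rK).
rewrite normrM exprS mulrC -mulrA ler_pM//.
have pos t : 0 <= t -> 0 <= t * r ^+ 2 by move=> t0; rewrite mulr_ge0 ?sqr_ge0.
apply: le_trans (expRN_lipschitz _ _ (pos _ nu0) (pos _ mu0)) _.
rewrite -mulrBl normrM (distrC nu) mulrC ler_wpM2r// ger0_norm ?sqr_ge0//.
exact: sqr_norm_le.
Qed.

Lemma damping_lipschitz mu K r s : 0 <= mu -> `|r| <= K -> `|s| <= K ->
  `|damping mu r - damping mu s| <= 3 * (mu * K ^+ 2) * `|r - s|.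
Proof.
move=> mu0 rK sK; have K0 : 0 <= K by rewrite (le_trans _ rK).
have -> : damping mu r - damping mu s = (1 - expR (- (mu * r ^+ 2))) * (r - s)
  + (expR (- (mu * s ^+ 2)) - expR (- (mu * r ^+ 2))) * s.
  by rewrite /damping; ring.
have pos t : 0 <= mu * t ^+ 2 by rewrite mulr_ge0 ?sqr_ge0.
have e1 : `|1 - expR (- (mu * r ^+ 2))| <= mu * K ^+ 2.
  have := expRN_lipschitz 0 (mu * r ^+ 2) (lexx _) (pos _).
  rewrite oppr0 expR0 sub0r normrN (ger0_norm (pos _)) => /le_trans; apply.
  by rewrite ler_wpM2l// sqr_norm_le.
have e2 : `|expR (- (mu * s ^+ 2)) - expR (- (mu * r ^+ 2))|
    <= mu * (2 * K) * `|r - s|.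
  apply: le_trans (expRN_lipschitz _ _ (pos _) (pos _)) _.
  have -> : mu * s ^+ 2 - mu * r ^+ 2 = mu * (s + r) * (s - r) by ring.
  rewrite !normrM (distrC s) (ger0_norm mu0) ler_wpM2r// ler_wpM2l//.
  by rewrite (le_trans (ler_normD _ _))//; lra.
apply: le_trans (ler_normD _ _) _; rewrite 2!normrM.
apply: le_trans (lerD (ler_wpM2r _ e1) (ler_pM _ _ e2 sK)) _ => //.
by rewrite le_eqVlt; apply/orP; left; apply/eqP; ring.
Qed.

(** The pointwise form of Gibbs's inequality; the terms with [p = 0] are
    covered by [0 * ln 0 = 0]. *)
Lemma mul_ln_le p q : 0 <= p -> 0 < q -> p * (ln q - ln p) <= q - p.
Proof.
rewrite le_eqVlt => /predU1P[<- q0|p0 q0]; first by rewrite mul0r subr0 ltW.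
have e : q = p * expR (ln q - ln p).
  by rewrite expRB !lnK ?posrE// mulrCA mulfV ?mulr1// gt_eqF.
have := expR_ge1Dx (ln q - ln p); rewrite -(ler_pM2l p0) -e; lra.
Qed.

Lemma mul_ln_lt p q : 0 <= p -> 0 < q -> p != q -> p * (ln q - ln p) < q - p.
Proof.
rewrite le_eqVlt => /predU1P[<- q0 _|p0 q0 pq]; first by rewrite mul0r subr0.
have e : q = p * expR (ln q - ln p).
  by rewrite expRB !lnK ?posrE// mulrCA mulfV ?mulr1// gt_eqF.
have /expR_gt1Dx : ln q - ln p != 0.
  by apply: contra pq; rewrite subr_eq0 => /eqP/ln_inj->; rewrite ?posrE.
by rewrite -(ltr_pM2l p0) -e; lra.
Qed.

End scalar.

(** * Gibbs weights and Gibbs's inequality *)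

Lemma dim_gt0_sum1 {R : realType} {m : nat} (f : 'I_m -> R) :
  \sum_(i < m) f i = 1 -> (0 < m)%N.
Proof.
by case: m f => // f; rewrite big_ord0 => /eqP; rewrite eq_sym oner_eq0.
Qed.

Section gibbs.
Context {R : realType} {m : nat}.
Implicit Types (mu nu : R) (p w s : 'cV[R]_m).

Definition wmean w s := \sum_(i < m) w i 0 * s i 0.

Definition partition_fun mu s := \sum_(i < m) expR (- (mu * s i 0)).

Definition gibbs mu s : 'cV[R]_m :=
  \col_i (expR (- (mu * s i 0)) / partition_fun mu s).

Lemma partition_fun_gt0 mu s : (0 < m)%N -> 0 < partition_fun mu s.
Proof.
move=> m0; rewrite /partition_fun (bigD1 (Ordinal m0))//=.
by rewrite ltr_wpDr ?expR_gt0// sumr_ge0// => i _; rewrite expR_ge0.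
Qed.

Lemma gibbs_gt0 mu s i : 0 < gibbs mu s i 0.
Proof.
have m0 : (0 < m)%N by apply: leq_ltn_trans (ltn_ord i).
by rewrite mxE divr_gt0 ?expR_gt0 ?partition_fun_gt0.
Qed.

Lemma sum_gibbs mu s : (0 < m)%N -> \sum_(i < m) gibbs mu s i 0 = 1.
Proof.
move=> m0; under eq_bigr do rewrite mxE.
by rewrite -mulr_suml mulfV// gt_eqF// partition_fun_gt0.
Qed.

Lemma gibbs0 s : gibbs 0 s = m%:R^-1 *: ones R m.
Proof.
apply/colP => i; rewrite !mxE mul0r oppr0 expR0 mul1r mulr1; congr _^-1.
rewrite /partition_fun (eq_bigr (fun=> 1)); first by rewrite sumr_const card_ord.
by move=> j _; rewrite mul0r oppr0 expR0.
Qed.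

Lemma ln_gibbs mu s i :
  ln (gibbs mu s i 0) = - (mu * s i 0) - ln (partition_fun mu s).
Proof.
have m0 : (0 < m)%N by apply: leq_ltn_trans (ltn_ord i).
by rewrite mxE ln_div ?posrE ?expR_gt0 ?partition_fun_gt0// expRK.
Qed.

Lemma gibbs_inj mu nu s i j : s i 0 != s j 0 -> gibbs mu s = gibbs nu s ->
  mu = nu.
Proof.
move=> sij e; have l k : ln (gibbs mu s k 0) = ln (gibbs nu s k 0) by rewrite e.
have := l i; have := l j; rewrite !ln_gibbs => lj li.
have : (mu - nu) * (s i 0 - s j 0) == 0 by apply/eqP; lra.
by rewrite mulf_eq0 !subr_eq0 (negbTE sij) orbF => /eqP.
Qed.

(** Minus the relative entropy of [p] with respect to the Gibbs weights. *)
Let gap mu s p := \sum_(i < m) p i 0 * (ln (gibbs mu s i 0) - ln (p i 0)).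

Let gapE mu s p : \sum_(i < m) p i 0 = 1 ->
  gap mu s p = entropy p - mu * wmean p s - ln (partition_fun mu s).
Proof.
move=> p1; rewrite /entropy /wmean mulr_sumr -sumrN -sumrB.
have -> : ln (partition_fun mu s) = \sum_i p i 0 * ln (partition_fun mu s).
  by rewrite -mulr_suml p1 mul1r.
rewrite -sumrB.
by apply: eq_bigr => i _; rewrite ln_gibbs; ring.
Qed.

Lemma entropy_gibbs mu s : (0 < m)%N ->
  entropy (gibbs mu s) - mu * wmean (gibbs mu s) s = ln (partition_fun mu s).
Proof.
move=> m0; apply/eqP; rewrite -subr_eq0 -gapE ?sum_gibbs// /gap big1// => i _.
by rewrite subrr mulr0.
Qed.

Lemma gibbs_le mu s p : (forall i, 0 <= p i 0) -> \sum_(i < m) p i 0 = 1 ->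
  entropy p - mu * wmean p s <= ln (partition_fun mu s).
Proof.
move=> p0 p1; have m0 := dim_gt0_sum1 (fun i => p i 0) p1.
rewrite -subr_le0 -gapE//.
apply: le_trans (ler_sum _ (fun i _ => mul_ln_le _ _ (p0 i) (gibbs_gt0 mu s i))) _.
by rewrite sumrB sum_gibbs// p1 subrr.
Qed.

Lemma gibbs_lt mu s p : (forall i, 0 <= p i 0) -> \sum_(i < m) p i 0 = 1 ->
  p != gibbs mu s -> entropy p - mu * wmean p s < ln (partition_fun mu s).
Proof.
move=> p0 p1 pg; have m0 := dim_gt0_sum1 (fun i => p i 0) p1.
have [k pk] : exists k, p k 0 != gibbs mu s k 0.
  apply/existsP; move: pg; apply: contraR => /existsPn e.
  by apply/eqP/colP => i; apply/eqP; rewrite -[_ == _]negbK e.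
rewrite -subr_lt0 -gapE//.
have -> : 0 = \sum_(i < m) (gibbs mu s i 0 - p i 0).
  by rewrite sumrB sum_gibbs// p1 subrr.
rewrite /gap (bigD1 k)//= [ltRHS](bigD1 k)//= ltr_leD ?mul_ln_lt ?gibbs_gt0//.
by apply: ler_sum => i _; rewrite mul_ln_le// gibbs_gt0.
Qed.

(** The Gibbs weights maximize [H - mu <., s>] and the uniform ones maximize
    [H]; for [mu < 0] this is only possible if the former have a mean at least
    as large.  At [mu = 0] the two coincide. *)
Lemma wmean_gibbs_npos mu s : (0 < m)%N -> mu <= 0 ->
  wmean (m%:R^-1 *: ones R m) s <= wmean (gibbs mu s) s.
Proof.
move=> m0; rewrite -(gibbs0 s) le_eqVlt => /predU1P[->//|mu0].
have := @gibbs_le mu s (gibbs 0 s) (fun i => ltW (gibbs_gt0 0 s i)) (sum_gibbs 0 s m0).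
have := @gibbs_le 0 s (gibbs mu s) (fun i => ltW (gibbs_gt0 mu s i)) (sum_gibbs mu s m0).
rewrite -!entropy_gibbs// !mul0r !subr0 => h1 h2; nra.
Qed.

(** The Lagrange multiplier [lambda] of the constraint [sum w = 1] is fixed by
    the normalizing constant. *)
Lemma ln_add_gibbsP lambda mu w s : (0 < m)%N -> (forall i, 0 < w i 0) ->
    \sum_(i < m) w i 0 = 1 ->
    (forall i, ln (w i 0) + (1 + lambda) + mu * s i 0 = 0) ->
  lambda = ln (partition_fun mu s) - 1 /\ w = gibbs mu s.
Proof.
move=> m0 w0 w1 e.
have wE i : w i 0 = expR (- (mu * s i 0)) / expR (1 + lambda).
  by rewrite -expRB -[LHS]lnK ?posrE//; congr expR; have := e i; lra.
have Z : partition_fun mu s = expR (1 + lambda).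
  move: w1; under eq_bigr do rewrite wE.
  by rewrite -mulr_suml => /divr1_eq.
split; first by rewrite Z expRK; ring.
by apply/colP => i; rewrite wE mxE Z.
Qed.

End gibbs.

(** * Bounds for the maximum norm of matrices *)

Section mx_norm_bounds.
Context {R : realType}.

Lemma ler_coord_mx_norm m n (M : 'M[R]_(m, n)) i j : `|M i j| <= `|M|.
Proof.
by rewrite [leRHS]/Num.Def.normr /= mx_normrE; apply/bigmax_geP; right => /=; exists (i, j).
Qed.

Lemma ler_mx_norm m n (M : 'M[R]_(m, n)) (c : R) : 0 <= c ->
  (forall i j, `|M i j| <= c) -> `|M| <= c.
Proof.
by move=> c0 Mc; rewrite [leLHS]/Num.Def.normr /= mx_normrE; apply/bigmax_leP; split.
Qed.

Lemma ler_mulmx_norm m n (M : 'M[R]_(m, n)) (v : 'cV[R]_n) :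
  `|M *m v| <= n%:R * `|M| * `|v|.
Proof.
apply: ler_mx_norm => [|i j]; first by rewrite !mulr_ge0.
rewrite mxE (le_trans (ler_norm_sum _ _ _))//.
have -> : n%:R * `|M| * `|v| = \sum_(k < n) `|M| * `|v|.
  by rewrite sumr_const card_ord -mulrA mulr_natl.
by apply: ler_sum => k _; rewrite normrM ler_pM// ler_coord_mx_norm.
Qed.

End mx_norm_bounds.

(** * Stationary points of the partition function *)

(** Of two maximizers for different prices, the one for the larger price has
    the smaller cost. *)
Lemma exchange_lt {R : realType} (a c es et mu nu : R) : mu < nu ->
  c - mu * et <= a - mu * es -> a - nu * es < c - nu * et -> et < es.
Proof.
move=> munu h1 h2; have : (nu - mu) * (et - es) < 0 by lra.
by rewrite pmulr_rlt0 ?subr_gt0// subr_lt0.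
Qed.

Section weighted_least_squares.
Context {R : realType} {m n : nat} (A : 'M[R]_(m, n)) (b : 'cV[R]_m).
Implicit Types (mu : R) (x y : 'cV[R]_n).

Lemma sum_sqr_mulmx (v : 'cV[R]_m) : \sum_i v i 0 ^+ 2 = (v^T *m v) 0 0.
Proof. by rewrite mxE; apply: eq_bigr => i _; rewrite mxE expr2. Qed.

Lemma gram_unitmx : \rank A = n -> A^T *m A \in unitmx.
Proof.
move=> rkA; rewrite -row_free_unit -kermx_eq0; apply/rowV0P => u /sub_kermxP u0.
have /eqP : \sum_i (A *m u^T) i 0 ^+ 2 = 0.
  by rewrite sum_sqr_mulmx trmx_mul trmxK !mulmxA -(mulmxA u) u0 mul0mx mxE.
rewrite psumr_eq0 => [/allP Au0|i _]; last exact: sqr_ge0.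
have free : row_free A^T by rewrite /row_free mxrank_tr rkA.
apply/eqP; rewrite -(mulmx_free_eq0 _ free) -trmx_eq0 trmx_mul trmxK; apply/eqP.
apply/colP => i; apply/eqP; rewrite [eqbRHS]mxE.
by have := Au0 i (mem_index_enum _); rewrite /= sqrf_eq0.
Qed.

Definition resid x := A *m x - b.

Lemma residB x y i : resid y i 0 - resid x i 0 = (A *m (y - x)) i 0.
Proof. by rewrite mulmxBr !mxE; ring. Qed.

(** The weighted normal equations for the Gibbs weights of [x] itself.  The
    positive factor [1 / Z] of the weights is left out, which makes this minus
    half the gradient of [Z_mu] divided by [mu], meaningful at [mu = 0] too. *)
Definition gibbs_crit mu x := A^T *m
  (\col_i (expR (- (mu * resid x i 0 ^+ 2)) * resid x i 0)) = 0.

Lemma gibbs_crit_orth mu x y : gibbs_crit mu x ->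
  \sum_i expR (- (mu * resid x i 0 ^+ 2)) *
    (resid x i 0 * (resid y i 0 - resid x i 0)) = 0.
Proof.
move=> /(congr1 (fun v => ((y - x)^T *m v) 0 0)).
rewrite mulmxA -trmx_mul mulmx0 !mxE => sum0; rewrite -[RHS]sum0.
by apply: eq_bigr => i _; rewrite residB [_^T _ _]mxE [in RHS]mxE; ring.
Qed.

(** Summing [expRN_sqr_tangent] over the residuals, the linear terms cancel by
    stationarity and only the negative quadratic ones remain. *)
Lemma partition_fun_crit_bound mu K x y : 0 <= mu -> mu * K ^+ 2 <= 16^-1 ->
    (forall i, `|resid x i 0| <= K) -> (forall i, `|resid y i 0| <= K) ->
    gibbs_crit mu x ->
  partition_fun mu (vsq (resid y)) <= partition_fun mu (vsq (resid x)) -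
    mu / 2 * \sum_i expR (- (mu * resid x i 0 ^+ 2)) *
                    (resid y i 0 - resid x i 0) ^+ 2.
Proof.
move=> mu0 muK xK yK /gibbs_crit_orth - /(_ y) orth.
pose d i := resid y i 0 - resid x i 0.
pose e i := expR (- (mu * resid x i 0 ^+ 2)).
have -> : partition_fun mu (vsq (resid x)) - mu / 2 * \sum_i e i * d i ^+ 2 =
    \sum_i e i * (1 - 2 * mu * (resid x i 0 * d i) - mu / 2 * d i ^+ 2).
  transitivity (partition_fun mu (vsq (resid x)) - mu / 2 * \sum_i e i * d i ^+ 2
    - 2 * mu * \sum_i e i * (resid x i 0 * d i)); first by rewrite orth mulr0 subr0.
  rewrite /partition_fun !mulr_sumr -!sumrB; apply: eq_bigr => i _.
  by rewrite mxE /e; ring.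
apply: ler_sum => i _; rewrite [vsq _ _ _]mxE.
exact: expRN_sqr_tangent mu K _ _ mu0 muK (xK i) (yK i).
Qed.

Lemma partition_fun_crit_max mu K x y : 0 <= mu -> mu * K ^+ 2 <= 16^-1 ->
    (forall i, `|resid x i 0| <= K) -> (forall i, `|resid y i 0| <= K) ->
    gibbs_crit mu x ->
  partition_fun mu (vsq (resid y)) <= partition_fun mu (vsq (resid x)).
Proof.
move=> mu0 muK xK yK crit.
apply: le_trans (partition_fun_crit_bound _ _ _ _ mu0 muK xK yK crit) _.
rewrite lerBlDr lerDl mulr_ge0 ?divr_ge0// sumr_ge0// => i _.
by rewrite mulr_ge0 ?expR_ge0 ?sqr_ge0.
Qed.

Lemma partition_fun_crit_lt mu K x y : 0 < mu -> mu * K ^+ 2 <= 16^-1 ->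
    (forall i, `|resid x i 0| <= K) -> (forall i, `|resid y i 0| <= K) ->
    gibbs_crit mu x -> resid x != resid y ->
  partition_fun mu (vsq (resid y)) < partition_fun mu (vsq (resid x)).
Proof.
move=> mu0 muK xK yK crit xy.
apply: le_lt_trans (partition_fun_crit_bound _ _ _ _ (ltW mu0) muK xK yK crit) _.
have [k rk] : exists k, resid x k 0 != resid y k 0.
  apply/existsP; move: xy; apply: contraR => /existsPn e.
  by apply/eqP/colP => i; apply/eqP; rewrite -[_ == _]negbK e.
rewrite ltrBlDr ltrDl mulr_gt0 ?divr_gt0// (bigD1 k)//= ltr_wpDr//.
  by rewrite sumr_ge0// => i _; rewrite mulr_ge0 ?expR_ge0 ?sqr_ge0.
by rewrite mulr_gt0 ?expR_gt0// exprn_even_gt0//= subr_eq0 eq_sym.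
Qed.

Definition fit_energy mu x :=
  wmean (gibbs mu (vsq (resid x))) (vsq (resid x)).

(** If the residual vectors differ, then [partition_fun_crit_lt] makes one of
    the two comparisons strict.  If they agree, then the weights must differ,
    since Gibbs weights determine [mu] on a non-constant vector, and Gibbs's
    inequality is strict. *)
Lemma fit_energy_decr mu nu K x y i j : 0 <= mu -> mu < nu ->
    nu * K ^+ 2 <= 16^-1 ->
    (forall i, `|resid x i 0| <= K) -> (forall i, `|resid y i 0| <= K) ->
    `|resid x i 0| != `|resid x j 0| ->
    gibbs_crit mu x -> gibbs_crit nu y ->
  fit_energy nu y < fit_energy mu x.
Proof.
move=> mu0 munu nuK xK yK rij cx cy.
have m0 : (0 < m)%N by apply: leq_ltn_trans (ltn_ord i).
have nu0 : 0 < nu by apply: le_lt_trans munu.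
have muK : mu * K ^+ 2 <= 16^-1.
  by rewrite (le_trans _ nuK)// ler_wpM2r ?sqr_ge0// ltW.
rewrite /fit_energy; set s := vsq (resid x); set t := vsq (resid y).
have g0 (d : R) (u : 'cV[R]_m) k : 0 <= gibbs d u k 0 by apply/ltW/gibbs_gt0.
have h1 := gibbs_le mu t (gibbs nu t) (g0 _ _) (sum_gibbs nu t m0).
have lnZ (d : R) (u v : 'cV[R]_m) : partition_fun d u <= partition_fun d v ->
    ln (partition_fun d u) <= ln (partition_fun d v).
  by rewrite ler_ln ?posrE ?partition_fun_gt0.
have s1 := lnZ _ _ _ (partition_fun_crit_max _ _ _ _ mu0 muK xK yK cx).
have s2 : entropy (gibbs mu s) - nu * wmean (gibbs mu s) s <
    ln (partition_fun nu t).
  have [xy|xy] := eqVneq (resid x) (resid y).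
    have sij : s i 0 != s j 0.
      rewrite [s i 0]mxE [s j 0]mxE; apply: contra rij.
      by rewrite eqf_sqr => /orP[]/eqP->; rewrite ?normrN.
    rewrite -[t]/(vsq _) -xy; apply: gibbs_lt => //; first exact: sum_gibbs.
    apply/eqP => e; have := gibbs_inj _ _ _ _ _ sij e => munuE.
    by rewrite munuE ltxx in munu.
  apply: le_lt_trans (gibbs_le nu s _ (g0 _ _) (sum_gibbs mu s m0)) _.
  rewrite ltr_ln ?posrE ?partition_fun_gt0//.
  exact: partition_fun_crit_lt nu0 nuK yK xK cy (contra_neq esym xy).
have h := le_trans h1 s1; rewrite -(entropy_gibbs mu s m0) in h.
rewrite -(entropy_gibbs nu t m0) in s2.
exact: exchange_lt munu h s2.
Qed.

Hypothesis gram_unit : A^T *m A \in unitmx.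

(** Multiply by [(A^T A)^-1] and split the weighted residual into the residual
    minus its damped part. *)
Lemma gibbs_critP mu x : gibbs_crit mu x <-> x = xstar A b +
  invmx (A^T *m A) *m A^T *m (\col_i damping mu (resid x i 0)).
Proof.
have -> : (\col_i damping mu (resid x i 0)) = resid x -
    \col_i (expR (- (mu * resid x i 0 ^+ 2)) * resid x i 0).
  by apply/colP => i; rewrite !mxE /damping; ring.
rewrite /gibbs_crit; move: (\col_i _) => v.
have projK z : invmx (A^T *m A) *m A^T *m (A *m z) = z.
  by rewrite -mulmxA (mulmxA A^T) mulKmx.
rewrite /resid !mulmxBr projK -/(xstar A b) addrA subrKC.
rewrite -mulmxA; split=> [->|/eqP]; first by rewrite mulmx0 subr0.
rewrite -subr_eq0 opprB addrCA subrr addr0 => /eqP.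
by move=> /(congr1 (mulmx (A^T *m A))); rewrite mulKVmx// mulmx0.
Qed.

Lemma gibbs_crit0_xstar : gibbs_crit 0 (xstar A b).
Proof.
apply/gibbs_critP; set v := \col_i _; suff -> : v = 0 by rewrite mulmx0 addr0.
by apply/colP => i; rewrite !mxE damping0.
Qed.

Lemma wmean_uniform_vsq (v : 'cV[R]_m) :
  wmean (m%:R^-1 *: ones R m) (vsq v) = m%:R^-1 * \sum_i v i 0 ^+ 2.
Proof.
rewrite mulr_sumr /wmean; apply: eq_bigr => i _.
by rewrite mxE [ones _ _ _ _]mxE mulr1 [vsq _ _ _]mxE.
Qed.

Lemma fit_energy0_xstar : fit_energy 0 (xstar A b) = Euw A b.
Proof.
rewrite /fit_energy gibbs0 wmean_uniform_vsq /Euw /norm2 sqr_sqrtr//.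
by apply: sumr_ge0 => i _; exact: sqr_ge0.
Qed.

(** Compare with the uniform weights at the same [x], and then use that
    [xstar] minimizes the sum of squares. *)
Lemma Euw_le_fit_energy mu x : (0 < m)%N -> mu <= 0 ->
  Euw A b <= fit_energy mu x.
Proof.
move=> m0 mu0; apply: le_trans (wmean_gibbs_npos _ _ m0 mu0).
rewrite -fit_energy0_xstar /fit_energy gibbs0.
pose r i := resid (xstar A b) i 0; pose d i := resid x i 0 - r i.
have orth : \sum_i r i * d i = 0.
  rewrite -[RHS](gibbs_crit_orth 0 (xstar A b) x gibbs_crit0_xstar).
  by apply: eq_bigr => i _; rewrite mul0r oppr0 expR0 mul1r.
rewrite !wmean_uniform_vsq ler_wpM2l ?invr_ge0//.
have -> : \sum_i resid x i 0 ^+ 2 =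
    \sum_i r i ^+ 2 + 2 * \sum_i r i * d i + \sum_i d i ^+ 2.
  by rewrite mulr_sumr -!big_split; apply: eq_bigr => i _ /=; rewrite /d; ring.
by rewrite orth mulr0 addr0 lerDl sumr_ge0// => i _; exact: sqr_ge0.
Qed.

Lemma F_eq0P lambda mu (w : 'cV[R]_m) x E : (0 < m)%N -> pos_vec w ->
  F A b lambda mu w x E = 0 <->
  [/\ lambda = ln (partition_fun mu (vsq (resid x))) - 1,
      w = gibbs mu (vsq (resid x)), gibbs_crit mu x & fit_energy mu x = E].
Proof.
move=> m0 w0; set s := vsq (resid x).
have F1 : (ones R m)^T *m w - 1%:M = 0 <-> \sum_i w i 0 = 1.
  have e : ((ones R m)^T *m w - 1%:M) 0 0 = \sum_i w i 0 - 1.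
    by rewrite !mxE; congr (_ - _); apply: eq_bigr => i _; rewrite !mxE mul1r.
  split=> [F0|w1]; first by move: e; rewrite F0 mxE; lra.
  by apply/matrixP => i j; rewrite !ord1 e w1 subrr mxE.
have F2 : w^T *m s - E%:M = 0 <-> wmean w s = E.
  have e : (w^T *m s - E%:M) 0 0 = wmean w s - E.
    by rewrite !mxE; congr (_ - _); apply: eq_bigr => i _; rewrite mxE.
  split=> [F0|w1]; first by move: e; rewrite F0 mxE; lra.
  by apply/matrixP => i j; rewrite !ord1 e w1 subrr mxE.
have F3 : vlog w + (1 + lambda) *: ones R m + mu *: s = 0 <->
    forall i, ln (w i 0) + (1 + lambda) + mu * s i 0 = 0.
  have e i : (vlog w + (1 + lambda) *: ones R m + mu *: s) i 0 =
      ln (w i 0) + (1 + lambda) + mu * s i 0.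
    by rewrite !mxE mulr1.
  split=> [F0 i|w1]; first by rewrite -e F0 mxE.
  by apply/colP => i; rewrite e w1 mxE.
have F4 : w = gibbs mu s ->
    A^T *m diag_mx w^T *m A *m x - A^T *m diag_mx w^T *m b = 0 <->
    gibbs_crit mu x.
  move=> ->; rewrite -mulmxA -mulmxBr -mulmxA -/(resid x).
  have -> : diag_mx (gibbs mu s)^T *m resid x = (partition_fun mu s)^-1 *:
      \col_i (expR (- (mu * resid x i 0 ^+ 2)) * resid x i 0).
    by apply/colP => i; rewrite mul_diag_mx !mxE; ring.
  rewrite -scalemxAr /gibbs_crit; split=> [/eqP|->]; last by rewrite scaler0.
  by rewrite scaler_eq0 invr_eq0 gt_eqF ?partition_fun_gt0//= => /eqP.
rewrite /F -/(resid x) -/s; split.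
  move/eqP; rewrite !col_mx_eq0.
  case/andP=> /andP[/andP[/eqP/F1 w1 /eqP/F2 wE] /eqP/F3 lnw] /eqP c.
  have [lE gE] := ln_add_gibbsP _ _ _ _ m0 w0 w1 lnw.
  by split=> //; [exact/F4|rewrite /fit_energy -/s -gE].
case=> lE wE c eE; apply/eqP; rewrite !col_mx_eq0.
rewrite -!andbA; apply/and4P; split; apply/eqP.
- by apply/F1; rewrite wE sum_gibbs.
- by apply/F2; rewrite wE.
- by apply/F3 => i; rewrite wE ln_gibbs lE; ring.
- exact/F4.
Qed.

End weighted_least_squares.

(** * The branch of stationary points *)

(** Matrices are complete and normed; joining the two structures makes them
    usable in the Banach fixed-point theorem. *)
HB.instance Definition _ (R : realType) (m n : nat) :=
  NormedModule.on 'M[R]_(m, n).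

Lemma contraction_fixed_point {R : realType} {X : completeNormedModType R}
    (c : X) (rho : R) (f : X -> X) : 0 < rho ->
  (forall x, `|x - c| <= rho -> `|f x - c| <= rho) ->
  (forall x y, `|x - c| <= rho -> `|y - c| <= rho ->
     `|f x - f y| <= 2^-1 * `|x - y|) ->
  exists2 x, `|x - c| <= rho & x = f x.
Proof.
move=> rho0 fball flip.
have ballE x : closed_ball c rho x <-> `|x - c| <= rho.
  by rewrite closed_ballE// distrC.
have fS : set_fun (closed_ball c rho) (closed_ball c rho) f.
  by move=> x /ballE cx; apply/ballE/fball.
have ctr : is_contraction (mkfun_fun fS).
  exists (2^-1)%:nng; split; first by rewrite /= invf_lt1// ltr1n.
  by case=> x y [/ballE cx /ballE cy]; exact: flip.
have [||x /ballE cx fx] := banach_fixed_point ctr; last by exists x.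
- exact: closed_ball_closed.
- by exists c; exact: closed_ballxx.
Qed.

Section solution_branch.
Context {R : realType} {m n : nat} (A : 'M[R]_(m, n)) (b : 'cV[R]_m).
Hypothesis gram_unit : A^T *m A \in unitmx.

Let proj := invmx (A^T *m A) *m A^T.

Let T mu x := xstar A b + proj *m (\col_i damping mu (resid A b x i 0)).

Let c1 := n%:R * `|A|.
Let c2 := m%:R * `|proj|.

Let c1_ge0 : 0 <= c1. Proof. by rewrite mulr_ge0. Qed.
Let c2_ge0 : 0 <= c2. Proof. by rewrite mulr_ge0. Qed.

Let T0 x : T 0 x = xstar A b.
Proof.
rewrite /T; set v := \col_i _; suff -> : v = 0 by rewrite mulmx0 addr0.
by apply/colP => i; rewrite !mxE damping0.
Qed.

Lemma resid_lipschitz x y i :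
  `|resid A b x i 0 - resid A b y i 0| <= c1 * `|x - y|.
Proof.
by rewrite residB (le_trans (ler_coord_mx_norm _ _ _ _ _))// ler_mulmx_norm.
Qed.

Let TB mu nu x y c : 0 <= c ->
  (forall i, `|damping mu (resid A b x i 0) - damping nu (resid A b y i 0)|
     <= c) ->
  `|T mu x - T nu y| <= c2 * c.
Proof.
move=> c0 h; rewrite /T opprD addrACA subrr add0r -mulmxBr.
apply: le_trans (ler_mulmx_norm _ _ _ _) _; rewrite ler_wpM2l//.
by apply: ler_mx_norm => // i j; have := h i; rewrite ord1 !mxE.
Qed.

(** The radius [rho] keeps the residuals so close to those at [xstar] that
    [|r_i|] and [|r_j|] stay distinct.  [K] bounds the residuals on this ball.
    [mu0] is then taken small enough for the tangent inequality, for a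
    contraction of factor one half, and for the ball to be mapped into its own
    interior. *)
Lemma gibbs_crit_branch i j :
  `|rstar A b i 0| != `|rstar A b j 0| ->
  exists rho mu0 K L : R, [/\ 0 < rho, 0 < mu0, mu0 * K ^+ 2 <= 16^-1,
    forall x, `|x - xstar A b| <= rho ->
      (forall k, `|resid A b x k 0| <= K) /\
      `|resid A b x i 0| != `|resid A b x j 0| &
    exists xi : R -> 'cV[R]_n,
      (forall mu, 0 <= mu <= mu0 -> [/\ `|xi mu - xstar A b| < rho,
         gibbs_crit A b mu (xi mu) & forall x, `|x - xstar A b| <= rho ->
           gibbs_crit A b mu x -> x = xi mu]) /\
      (forall mu nu, 0 <= mu <= mu0 -> 0 <= nu <= mu0 ->
         `|xi mu - xi nu| <= L * `|mu - nu|)].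
Proof.
move=> rij.
pose delta := `| `|rstar A b i 0| - `|rstar A b j 0| |.
have delta0 : 0 < delta by rewrite normr_gt0 subr_eq0.
(* Residuals move by at most [c1 * rho <= delta / 4] on the ball, less than half
   the gap [delta]. *)
pose rho := delta / (4 * (c1 + 1)).
have rho0 : 0 < rho by rewrite divr_gt0// mulr_gt0// ltr_wpDl.
have c1rho : c1 * rho <= delta / 4.
  have : rho * (4 * (c1 + 1)) = delta.
    by rewrite divfK// gt_eqF// mulr_gt0// ltr_wpDl.
  by move: rho0; clearbody rho c1; lra.
pose K := `|rstar A b| + delta.
have K0 : 0 < K by rewrite ltr_wpDl.
pose L := c2 * K ^+ 3.
have L0 : 0 <= L by rewrite mulr_ge0// exprn_ge0// ltW.
have bK x : `|x - xstar A b| <= rho ->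
    forall k, `|resid A b x k 0 - rstar A b k 0| <= delta / 4.
  move=> xrho k; apply: le_trans (resid_lipschitz x (xstar A b) k) _.
  by apply: le_trans c1rho; rewrite ler_wpM2l.
have xK x : `|x - xstar A b| <= rho -> forall k, `|resid A b x k 0| <= K.
  move=> /bK xrho k; have := xrho k.
  have := ler_coord_mx_norm _ _ (rstar A b) k 0.
  have := ler_normD (resid A b x k 0 - rstar A b k 0) (rstar A b k 0).
  rewrite subrK /K; lra.
(* The four summands give [mu0 > 0] and the three bounds below. *)
pose mu0 := (1 + 16 * K ^+ 2 + 6 * K ^+ 2 * c1 * c2 + 2 * L / rho)^-1.
have [mu0_gt0 mu0K mu0c mu0L] : [/\ 0 < mu0, mu0 * K ^+ 2 <= 16^-1,
    c2 * (3 * (mu0 * K ^+ 2) * c1) <= 2^-1 & L * mu0 <= rho / 2].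
  have K20 := sqr_ge0 K.
  have K2 : 0 <= 16 * K ^+ 2 by apply: mulr_ge0.
  have Kc : 0 <= 6 * K ^+ 2 * c1 * c2.
    by apply: mulr_ge0 => //; apply: mulr_ge0 => //; apply: mulr_ge0.
  have Lr : 0 <= 2 * L / rho by apply: divr_ge0; [apply: mulr_ge0|exact: ltW].
  have D0 : 0 < 1 + 16 * K ^+ 2 + 6 * K ^+ 2 * c1 * c2 + 2 * L / rho by lra.
  have mul_le t : t <= 1 + 16 * K ^+ 2 + 6 * K ^+ 2 * c1 * c2 + 2 * L / rho ->
      mu0 * t <= 1.
    by move=> tD; rewrite /mu0 [X in X <= _]mulrC ler_pdivrMr// mul1r.
  split; first by rewrite invr_gt0.
  - have : mu0 * (16 * K ^+ 2) <= 1 by apply: mul_le; lra.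
    by lra.
  - have : mu0 * (6 * K ^+ 2 * c1 * c2) <= 1 by apply: mul_le; lra.
    by lra.
  - have : mu0 * (2 * L / rho) <= 1 by apply: mul_le; lra.
    by rewrite mulrA ler_pdivrMr// mul1r; lra.
clearbody mu0.
have Tx mu x y : 0 <= mu <= mu0 -> `|x - xstar A b| <= rho ->
    `|y - xstar A b| <= rho -> `|T mu x - T mu y| <= 2^-1 * `|x - y|.
  move=> /andP[m0 mm0] xr yr.
  have K20 : 0 <= mu * K ^+ 2 by rewrite mulr_ge0// sqr_ge0.
  have c0 : 0 <= 3 * (mu * K ^+ 2) by rewrite mulr_ge0.
  apply: le_trans (TB _ _ _ _ (3 * (mu * K ^+ 2) * (c1 * `|x - y|)) _ _) _.
  - by apply: mulr_ge0 => //; apply: mulr_ge0.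
  - move=> k; apply: le_trans (damping_lipschitz mu K _ _ m0 (xK _ xr k) (xK _ yr k)) _.
    by rewrite ler_wpM2l// resid_lipschitz.
  - rewrite (mulrA _ c1) mulrA ler_wpM2r//; apply: le_trans mu0c.
    apply: ler_wpM2l => //; apply: ler_wpM2r => //; apply: ler_wpM2l => //.
    by apply: ler_wpM2r => //; exact: sqr_ge0.
have Tmu mu nu x : 0 <= mu <= mu0 -> 0 <= nu <= mu0 ->
    `|x - xstar A b| <= rho -> `|T mu x - T nu x| <= L * `|mu - nu|.
  move=> /andP[m0 _] /andP[n0 _] xr; rewrite /L -mulrA; apply: TB => [|k].
    by rewrite mulr_ge0// exprn_ge0// ltW.
  exact: damping_lipschitz_param m0 n0 (xK _ xr k).
have Tball mu x : 0 <= mu <= mu0 -> `|x - xstar A b| <= rho ->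
    `|T mu x - xstar A b| < rho.
  move=> mm xr; rewrite -[X in _ - X](T0 x).
  apply: le_lt_trans (Tmu _ _ _ mm _ xr) _; first by rewrite lexx ltW.
  move: mm => /andP[m0 mm]; rewrite subr0 (ger0_norm m0).
  by apply: le_lt_trans (ler_wpM2l L0 mm) _; lra.
have ex_fix mu : exists x, 0 <= mu <= mu0 ->
    `|x - xstar A b| <= rho /\ x = T mu x.
  have [mm|_] := boolP (0 <= mu <= mu0); last by exists 0.
  have [x xr xT] := contraction_fixed_point (xstar A b) rho (T mu) rho0
    (fun x xr => ltW (Tball mu x mm xr)) (fun x y => Tx mu x y mm).
  by exists x.
have [xi xiP] := choice ex_fix.
exists rho, mu0, K, (2 * L); split => //.
  move=> x xr; split; first exact: xK.
  apply/eqP => e; have := bK x xr i; have := bK x xr j.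
  move: delta0; rewrite /delta.
  have := ler_dist_dist (resid A b x i 0) (rstar A b i 0).
  have := ler_dist_dist (resid A b x j 0) (rstar A b j 0).
  rewrite e; set u := `|resid A b x j 0|.
  set p := `|rstar A b i 0|; set q := `|rstar A b j 0|.
  have := ler_distD u p q; rewrite (distrC p u).
  by move=> h1 h2 h3 h4 h5 h6; lra.
exists xi; split=> [mu mm|mu nu mm nn].
  have [xr xT] := xiP mu mm; split.
  - by rewrite {1}xT Tball.
  - exact/gibbs_critP.
  - move=> x xr' crit; have xT' : x = T mu x by apply/gibbs_critP.
    apply/eqP; rewrite -subr_eq0 -normr_le0.
    by have := Tx mu x (xi mu) mm xr' xr; rewrite -xT -xT'; lra.
have [xr xT] := xiP mu mm; have [yr yT] := xiP nu nn.
have := ler_distD (T mu (xi nu)) (T mu (xi mu)) (T nu (xi nu)).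
rewrite -xT -yT => h; have := Tx mu (xi mu) (xi nu) mm xr yr.
have := Tmu mu nu (xi nu) mm nn yr; rewrite -xT -yT; lra.
Qed.

End solution_branch.

(** * Continuity of the energy along the branch *)

Section energy_continuity.
Context {R : realType} {m n : nat} (A : 'M[R]_(m, n)) (b : 'cV[R]_m).

Lemma cvg_sum (T I : Type) (F : set_system T) (r : seq I) (f : I -> T -> R)
    (l : I -> R) : Filter F -> (forall i, f i x @[x --> F] --> l i) ->
  \sum_(i <- r) f i x @[x --> F] --> \sum_(i <- r) l i.
Proof.
move=> FF fl; apply: (@cvg_big _ _ +%R 0 predT) => //.
by move=> z; exact: add_continuous.
Qed.

Lemma cvg_fit_energy (T : Type) (G : set_system T) (FG : Filter G)
    (mu : T -> R) (x : T -> 'cV[R]_n) mu0 x0 : (0 < m)%N ->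
  mu t @[t --> G] --> mu0 ->
  (forall k, resid A b (x t) k 0 @[t --> G] --> resid A b x0 k 0) ->
  fit_energy A b (mu t) (x t) @[t --> G] --> fit_energy A b mu0 x0.
Proof.
move=> m0 cmu cr.
have cs k : vsq (resid A b (x t)) k 0 @[t --> G] --> vsq (resid A b x0) k 0.
  rewrite [X in _ --> X]mxE; under eq_fun do rewrite mxE.
  exact: cvgM (cr k) (cr k).
have ce k : expR (- (mu t * vsq (resid A b (x t)) k 0)) @[t --> G] -->
    expR (- (mu0 * vsq (resid A b x0) k 0)).
  exact: (cvg_comp _ _ (cvgN (cvgM cmu (cs k))) (@continuous_expR R _)).
have cZ : partition_fun (mu t) (vsq (resid A b (x t))) @[t --> G] -->
    partition_fun mu0 (vsq (resid A b x0)) by exact: cvg_sum.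
apply: cvg_sum => k; apply: cvgM (cs k).
rewrite [X in _ --> X]mxE; under eq_fun do rewrite mxE.
by apply: cvgM (ce k) _; apply: cvgV cZ; rewrite gt_eqF ?partition_fun_gt0.
Qed.

Lemma continuous_fit_energy_lipschitz (xi : R -> 'cV[R]_n) (a c L : R) :
  (0 < m)%N ->
  (forall mu nu, mu \in `[a, c] -> nu \in `[a, c] ->
     `|xi mu - xi nu| <= L * `|mu - nu|) ->
  {within `[a, c], continuous (fun mu => fit_energy A b mu (xi mu))}.
Proof.
move=> m0 xiL; apply/subspace_continuousP => mu muI.
apply: cvg_fit_energy => //; first exact: cvg_within.
move=> k; pose C := n%:R * `|A| * `|L| + 1.
have C0 : 0 < C by rewrite ltr_wpDl// !mulr_ge0.
apply/cvgrPdist_le => e e0; near=> nu.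
have nuI : nu \in `[a, c] by near: nu; exact: withinT.
have munu : `|mu - nu| <= e / C.
  near: nu; apply: cvg_within.
  have /cvgrPdist_le := @cvg_id R (nbhs mu); apply.
  by rewrite divr_gt0.
apply: le_trans (resid_lipschitz _ _ _ _ _) _.
have /ler_wpM2l h := le_trans (xiL _ _ muI nuI) (ler_wpM2r (normr_ge0 _) (ler_norm L)).
apply: le_trans (h _ _) _; first by rewrite mulr_ge0.
rewrite mulrA; apply: (@le_trans _ _ (C * `|mu - nu|)).
  by rewrite ler_wpM2r// lerDl.
by rewrite mulrC -ler_pdivlMr.
Unshelve. all: end_near. Qed.

End energy_continuity.

(** * Local maximality and the main theorem *)

Lemma feasibleE (R : realType) (m n : nat) (A : 'M[R]_(m, n)) (b : 'cV[R]_m)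
    (E : R) (p : 'cV[R]_m * 'cV[R]_n) :
  feasible A b E p <-> [/\ forall i, 0 <= p.1 i 0, \sum_i p.1 i 0 = 1
    & wmean p.1 (vsq (resid A b p.2)) = E].
Proof.
rewrite /feasible /wmean /=; set lhs := \sum_(i < m) p.1 i 0 * _.
suff <- : lhs = \sum_i p.1 i 0 * vsq (resid A b p.2) i 0 by [].
apply: eq_bigr => i _; rewrite -row_mul mxE [vsq _ _ _]mxE /resid.
by rewrite [(_ - b) _ _]mxE [(- b) _ _]mxE.
Qed.

(** For feasible [q] near [x], Gibbs's inequality and the maximality of [x] for
    [Z_mu] bound [H(q) - mu E] by [ln Z_mu(x)], which is the value of
    [H - mu E] at the Gibbs weights. *)
Lemma gibbs_crit_local_maximizer (R : realType) (m n : nat) (A : 'M[R]_(m, n))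
    (b : 'cV[R]_m) (mu K rho : R) (x c : 'cV[R]_n) : (0 < m)%N ->
  0 <= mu -> mu * K ^+ 2 <= 16^-1 -> `|x - c| < rho ->
  (forall y, `|y - c| <= rho -> forall k, `|resid A b y k 0| <= K) ->
  gibbs_crit A b mu x ->
  local_maximizer (feasible A b (fit_energy A b mu x))
    (fun p => entropy p.1) (gibbs mu (vsq (resid A b x)), x).
Proof.
move=> m0 mu0 muK xc yK crit; set w := gibbs _ _; split.
  apply/feasibleE; split=> //=; last exact: sum_gibbs.
  by move=> i; apply/ltW/gibbs_gt0.
near=> q => /feasibleE[q0 q1 qE] /=.
have qc : `|q.2 - c| <= rho.
  rewrite -(subrK x q.2) -addrA (le_trans (ler_normD _ _))// -lerBrDr distrC.
  near: q; have /cvgrPdist_le : p.2 @[p --> nbhs (w, x)] --> x by exact: cvg_snd.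
  apply.
  by rewrite subr_gt0.
have Zle := partition_fun_crit_max _ _ _ _ _ _ mu0 muK (yK _ (ltW xc)) (yK _ qc) crit.
have lnZ : ln (partition_fun mu (vsq (resid A b q.2))) <=
    ln (partition_fun mu (vsq (resid A b x))).
  by rewrite ler_ln ?posrE ?partition_fun_gt0.
have := le_trans (gibbs_le mu _ _ q0 q1) lnZ.
by rewrite -(entropy_gibbs mu (vsq (resid A b x)) m0) qE lerD2r.
Unshelve. all: end_near. Qed.

Theorem theorem1 (R : realType) (m n : nat) (A : 'M[R]_(m, n)) (b : 'cV[R]_m)
    (le_nm : (n <= m)%N)
    (full_col_rank : \rank A = n)
    (not_const : ~ (forall i j : 'I_m, `|rstar A b i 0| = `|rstar A b j 0|)) :
  exists2 Delta : R, 0 < Delta &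
  exists2 U : set (R * R * 'cV[R]_m * 'cV[R]_n), nbhs (ystar A b) U &
  exists (lambda mu : R -> R) (w : R -> 'cV[R]_m) (x : R -> 'cV[R]_n),
  forall E : R, E \in `]Euw A b - Delta, Euw A b[ ->
    [/\ pos_vec (w E) /\ U (lambda E, mu E, w E, x E),
        F A b (lambda E) (mu E) (w E) (x E) E = 0,
        0 < mu E,
        local_maximizer (feasible A b E) (fun p => entropy p.1) (w E, x E)
      & forall (l' mu' : R) (w' : 'cV[R]_m) (x' : 'cV[R]_n),
          U (l', mu', w', x') -> pos_vec w' -> F A b l' mu' w' x' E = 0 ->
          (l', mu', w', x') = (lambda E, mu E, w E, x E)].
Proof.
have gram_unit := gram_unitmx A full_col_rank.
have [i [j rij]] : exists i j, `|rstar A b i 0| != `|rstar A b j 0|.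
  apply: contrapT => none; apply: not_const => i j; apply/eqP.
  by apply/negPn/negP => rij; apply: none; exists i, j.
have m0 : (0 < m)%N by apply: leq_ltn_trans (ltn_ord i).
have [rho [mu0 [K [L [rho0 mu00 mu0K ball [xi [xiP xiL]]]]]]] :=
  gibbs_crit_branch A b gram_unit i j rij.
pose e mu := fit_energy A b mu (xi mu).
have ePdecr mu nu : 0 <= mu -> mu < nu -> nu <= mu0 -> e nu < e mu.
  move=> mu_ge0 munu nu_le.
  have [|xr cx _] := xiP mu; first by rewrite mu_ge0 (le_trans (ltW munu) nu_le).
  have [|yr cy _] := xiP nu; first by rewrite nu_le andbT (le_trans mu_ge0 (ltW munu)).
  have [xK rxij] := ball _ (ltW xr); have [yK _] := ball _ (ltW yr).
  apply: (fit_energy_decr _ _ _ _ K _ _ _ _ mu_ge0 munu _ xK yK rxij cx cy).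
  by rewrite (le_trans _ mu0K)// ler_wpM2r ?sqr_ge0.
have xi0 : xi 0 = xstar A b.
  have [|_ _ uniq] := xiP 0; first by rewrite lexx ltW.
  apply/esym/uniq; first by rewrite subrr normr0 ltW.
  exact: gibbs_crit0_xstar.
have e0 : e 0 = Euw A b by rewrite /e xi0 fit_energy0_xstar.
exists (Euw A b - e mu0); first by rewrite subr_gt0 -e0 ePdecr.
(* [lambda] and [w] need no localization, as they are functions of [(mu, x)]
   on the solution set. *)
exists [set y | `|y.1.1.2| < mu0 /\ `|y.2 - xstar A b| < rho].
  near=> y => /=; split.
    rewrite -normrN -sub0r; near: y.
    have /cvgrPdist_lt : y.1.1.2 @[y --> ystar A b] --> (0 : R).
      apply: (@cvg_comp _ _ _ (fun y => y.1.1) snd _ (nbhs (ystar A b).1.1)).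
        apply: (@cvg_comp _ _ _ fst fst _ (nbhs (ystar A b).1)); exact: cvg_fst.
      exact: cvg_snd.
    by apply.
  rewrite distrC; near: y.
  have /cvgrPdist_lt : y.2 @[y --> ystar A b] --> xstar A b by exact: cvg_snd.
  by apply.
have ex_mu E : exists mu, E \in `]e mu0, Euw A b[ ->
    [/\ 0 < mu, mu < mu0 & e mu = E].
  have [EI|_] := boolP (E \in `]e mu0, Euw A b[); last by exists 0.
  move: (EI); rewrite in_itv/= => /andP[E1 E2].
  have cont := continuous_fit_energy_lipschitz A b xi 0 mu0 L m0 xiL.
  have [|mu] := @IVT _ e 0 mu0 E (ltW mu00) cont.
    rewrite e0 ge_min le_max; apply/andP; split.
      by rewrite (ltW E1) orbT.
    by rewrite (ltW E2).
  rewrite in_itv/= => /andP[mu_ge0 mu_le] emu; exists mu => _; split=> //.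
    rewrite lt_neqAle mu_ge0 andbT; apply/eqP => mu_eq0.
    by move: E2; rewrite -emu -mu_eq0 -/(e 0) e0 ltxx.
  rewrite lt_neqAle mu_le andbT; apply/eqP => mu_eq.
  by move: E1; rewrite -emu mu_eq -/(e mu0) ltxx.
have [mu muP] := choice ex_mu.
pose s E := vsq (resid A b (xi (mu E))).
exists (fun E => ln (partition_fun (mu E) (s E)) - 1), mu,
  (fun E => gibbs (mu E) (s E)), (fun E => xi (mu E)) => E.
rewrite subKr => /muP[mu_gt0 mu_lt muE].
have [|xr cx _] := xiP (mu E); first by rewrite !ltW.
have w0 : pos_vec (gibbs (mu E) (s E)) by move=> k; exact: gibbs_gt0.
split=> //.
- by split=> //=; split=> //; rewrite ger0_norm// ltW.
- exact/F_eq0P.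
- rewrite -[E in feasible _ _ E]muE.
  apply: (gibbs_crit_local_maximizer _ _ _ _ _ _ K rho _ _ m0 (ltW mu_gt0) _ xr) => //.
    by rewrite (le_trans _ mu0K)// ler_wpM2r ?sqr_ge0// ltW.
  by move=> y /ball[].
- move=> l' mu' w' x' [/= mu'_lt xr'] w'0 /(F_eq0P _ _ _ _ _ _ _ m0 w'0).
  case=> -> -> cx' eE.
  have mu'0 : 0 < mu'.
    rewrite ltNge; apply/negP => /(Euw_le_fit_energy A b gram_unit mu' x' m0).
    by rewrite eE -muE -e0 leNgt ePdecr// ltW.
  have mu'I : 0 <= mu' <= mu0 by rewrite (ltW mu'0) ltW// (le_lt_trans (ler_norm _)).
  have [_ _ uniq'] := xiP mu' mu'I.
  have x'E := uniq' x' (ltW xr') cx'.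
  have emu' : e mu' = e (mu E) by rewrite muE -eE /e -x'E.
  suff mumu : mu' = mu E by rewrite x'E mumu.
  move: mu'I => /andP[_ mu'_le].
  have [lt|lt|//] := ltgtP mu' (mu E).
    by have := ePdecr _ _ (ltW mu'0) lt (ltW mu_lt); rewrite emu' ltxx.
  by have := ePdecr _ _ (ltW mu_gt0) lt mu'_le; rewrite emu' ltxx.
Unshelve. all: end_near. Qed.
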